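(* Let $p\in\mathbb{N}$, $p\ge1$, and let $\Omega=\bigcup_{i=0}^{p-1}\left(\frac{\alpha_i}p,\frac{\alpha_i+1}p\right)$, with $|\Omega|=1$, $\alpha_i\in\mathbb{Z}$ for all $i=0,\dots,p-1$, $0=\alpha_0<\alpha_1<\dots<\alpha_{p-1}$. Assume that $\Omega$ has spectrum $\Lambda$ with period $p$, $\Lambda=\{\lambda_0=0,\lambda_1,\dots,\lambda_{p-1}\}+p\mathbb{Z}$. Let $U$ be the associated group of local translations and $B$ the spectral unitary matrix associated to $\Lambda$. Then $$B=M_\alpha D(\lambda)M_\alpha^*,\quad\text{where } M_\alpha=\frac1{\sqrt p}\left(e^{2\pi \mathrm{i}\frac1p\alpha_i\lambda_j}\right)_{i,j=0}^{p-1},\quad D(\lambda)=\operatorname{diag}\left(e^{2\pi \mathrm{i}\frac1p\lambda_0},\dots,e^{2\pi \mathrm{i}\frac1p\lambda_{p-1}}\right).$$ For $x\in\mathbb{R}$ let $a(x)$ be the unique integer such that $[x]_p:=x-\frac{a(x)}p\in[0,\frac1p)$. Then for $f\in L^2(\Omega)$, $t\in\mathbb{R}$, and (a.e.) $x\in(0,\frac1p)$, $$\begin{pmatrix}(U(t)f)(x+\frac{\alpha_0}p)\\ \vdots\\ (U(t)f)(x+\frac{\alpha_{p-1}}p)\end{pmatrix}=B^{a(x+t)}\begin{pmatrix}f([x+t]_p+\frac{\alpha_0}p)\\ \vdots\\ f([x+t]_p+\frac{\alpha_{p-1}}p)\end{pmatrix}.$$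
   Context: $\mathrm{i}$ (upright) is the imaginary unit; $e_\lambda(x)=e^{2\pi \mathrm{i}\lambda x}$; $|\Omega|$ is Lebesgue measure. $\Omega$ has spectrum $\Lambda\subset\mathbb{R}$ if $\{|\Omega|^{-1/2}e_\lambda:\lambda\in\Lambda\}$ is an orthonormal basis of $L^2(\Omega)$; $\Lambda$ has period $p$ if $\Lambda+p=\Lambda$. The group of local translations associated to $\Lambda$ is the strongly continuous one-parameter unitary group $U$ on $L^2(\Omega)$ determined by $U(t)e_\lambda=e^{2\pi \mathrm{i}\lambda t}e_\lambda$, $\lambda\in\Lambda$. The spectral unitary matrix associated to $\Lambda$: let $A$ be the self-adjoint operator on $L^2(\Omega)$ that is diagonal in the basis $\{e_\lambda\}_{\lambda\in\Lambda}$ with $Ae_\lambda=\lambda e_\lambda$ (so $U(t)=e^{2\pi \mathrm{i}tA}$); it is a self-adjoint extension of $\frac1{2\pi \mathrm{i}}\frac{d}{dx}$ on $C_c^\infty(\Omega)$. Let $J_i=(\frac{\alpha_i}p,\frac{\alpha_i+1}p)$, $i=0,\dots,p-1$ (each of the $p$ intervals counted separately), $\mathcal{D}_{\max}=\{f\in L^2(\Omega):f$ absolutely continuous on each $J_i$, $f'\in L^2(\Omega)\}$, and for $f\in\mathcal{D}_{\max}$ let $f_{\mathrm{left}},f_{\mathrm{right}}\in\mathbb{C}^p$ be the vectors whose $i$-th entries are the one-sided limits, from inside $J_i$, of $f$ at the left endpoint $\frac{\alpha_i}p$ and at the right endpoint $\frac{\alpha_i+1}p$ respectively. Then $B$ is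 the unique $p\times p$ unitary matrix such that $\operatorname{domain}(A)=\{f\in\mathcal{D}_{\max}:Bf_{\mathrm{left}}=f_{\mathrm{right}}\}$. *)

(* Defs.v *)
From HB Require Import structures.
From mathcomp Require Export all_boot all_order all_algebra.
From mathcomp Require Export all_classical all_reals all_analysis.
From mathcomp Require Export complex.

Set Implicit Arguments.
Unset Strict Implicit.
Unset Printing Implicit Defensive.

Export Order.TTheory GRing.Theory Num.Theory.
Export numFieldNormedType.Exports.

Local Open Scope classical_set_scope.
Local Open Scope ring_scope.

(* MathComp-Analysis provides integrals and limits of real (or extended real)
   functions only, so for functions with values in R[i] they are taken on
   real and imaginary parts.  Elements of L^2 are represented by functions
   R -> R[i], equality in L^2(Omega) being equality a.e. on Omega. *)

Section L2.
Context {R : realType}.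
Implicit Types (Omega Lambda : set R) (f g : R -> R[i]).

Notation mu := (@lebesgue_measure R).

(* e^{2 pi i x} *)
Definition e2pi (x : R) : R[i] := (cos (2 * pi * x) +i* sin (2 * pi * x))%C.

Definition expfun (l x : R) : R[i] := e2pi (l * x).

Definition modulus (z : R[i]) : R := ComplexField.Normc.normc z.

Definition cintegral Omega f : R[i] :=
  (Rintegral mu Omega (fun x => complex.Re (f x)) +i*
   Rintegral mu Omega (fun x => complex.Im (f x)))%C.

Definition L2norm Omega f : \bar R :=
  ((\int[mu]_(x in Omega) ((modulus (f x)) ^+ 2)%:E) `^ 2^-1)%E.

Definition L2 Omega f : Prop :=
  [/\ measurable_fun Omega (fun x => complex.Re (f x)),
      measurable_fun Omega (fun x => complex.Im (f x)) &
      (L2norm Omega f < +oo)%E].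

Definition inner Omega f g : R[i] :=
  cintegral Omega (fun x => f x * (g x)^*).

Definition aeeq Omega f g : Prop := {ae mu, forall x, Omega x -> f x = g x}.

Definition orthonormal_basis Omega (I : eqType) (S : set I)
    (phi : I -> R -> R[i]) : Prop :=
  [/\ forall i, S i -> L2 Omega (phi i),
      forall i j, S i -> S j -> inner Omega (phi i) (phi j) = (i == j)%:R &
      (* the linear span is dense *)
      forall f, L2 Omega f -> forall eps : R, 0 < eps ->
        exists (s : seq I) (c : I -> R[i]), (forall i, i \in s -> S i) /\
          (L2norm Omega (fun x => f x - \sum_(i <- s) c i * phi i x)%R
             < eps%:E)%E].

Definition has_spectrum Omega Lambda : Prop :=
  orthonormal_basis Omega Lambda
    (fun l x => ((Num.sqrt (fine (mu Omega)))^-1)%:C%C * expfun l x).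

Definition has_period Lambda (q : R) : Prop :=
  [set l + q | l in Lambda] = Lambda.

Definition linear_L2 Omega (T : (R -> R[i]) -> R -> R[i]) : Prop :=
  forall (c : R[i]) f g, L2 Omega f -> L2 Omega g ->
    aeeq Omega (T (fun x => c * f x + g x)) (fun x => c * T f x + T g x).

(* A unitary operator on L^2(Omega), given on representatives. *)
Definition unitary_L2 Omega (T : (R -> R[i]) -> R -> R[i]) : Prop :=
  [/\ forall f, L2 Omega f -> L2 Omega (T f),
      forall f g, L2 Omega f -> L2 Omega g ->
        aeeq Omega f g -> aeeq Omega (T f) (T g),
      linear_L2 Omega T,
      forall f g, L2 Omega f -> L2 Omega g ->
        inner Omega (T f) (T g) = inner Omega f g &
      forall g, L2 Omega g -> exists2 f, L2 Omega f & aeeq Omega (T f) g].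

Definition unitary_group Omega (U : R -> (R -> R[i]) -> R -> R[i]) : Prop :=
  [/\ forall t, unitary_L2 Omega (U t),
      forall f, L2 Omega f -> aeeq Omega (U 0 f) f,
      forall s t f, L2 Omega f ->
        aeeq Omega (U (s + t) f) (U s (U t f)) &
      forall f, L2 Omega f -> forall t0 : R,
        L2norm Omega (fun x => U t f x - U t0 f x) @[t --> t0] --> 0%E].

Definition local_translations Omega Lambda
    (U : R -> (R -> R[i]) -> R -> R[i]) : Prop :=
  unitary_group Omega U /\
  forall l, Lambda l -> forall t,
    aeeq Omega (U t (expfun l)) (fun x => e2pi (l * t) * expfun l x).

(* The graph of the self-adjoint operator A which is diagonal in the basis
   (expfun l), l in Lambda, with eigenvalues l: when Lambda is a spectrum,
   expansion in this basis turns A into the multiplication of coefficient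
   families by l, on its maximal domain. *)
Definition diag_op Omega Lambda f g : Prop :=
  [/\ L2 Omega f, L2 Omega g &
      forall l, Lambda l ->
        inner Omega g (expfun l) = l%:C%C * inner Omega f (expfun l)].

Definition diag_domain Omega Lambda f : Prop :=
  exists g, diag_op Omega Lambda f g.

Definition abs_continuous (a b : R) f : Prop :=
  forall eps : R, 0 < eps -> exists2 delta : R, 0 < delta &
    forall (m : nat) (u v : 'I_m -> R),
      (forall k, [/\ a < u k, u k <= v k & v k < b]) ->
      trivIset [set: 'I_m] (fun k => [set` `]u k, v k[]) ->
      \sum_(k < m) (v k - u k) < delta ->
      \sum_(k < m) modulus (f (v k) - f (u k)) < eps.

Definition has_derivative f (x : R) (z : R[i]) : Prop :=
  is_derive x 1 (fun y => complex.Re (f y)) (complex.Re z) /\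
  is_derive x 1 (fun y => complex.Im (f y)) (complex.Im z).

Definition lim_right f (a : R) : R[i] :=
  (lim (complex.Re (f x) @[x --> a^'+]) +i*
   lim (complex.Im (f x) @[x --> a^'+]))%C.

Definition lim_left f (a : R) : R[i] :=
  (lim (complex.Re (f x) @[x --> a^'-]) +i*
   lim (complex.Im (f x) @[x --> a^'-]))%C.

End L2.

Section UnionOfIntervals.
Context {R : realType} {p : nat}.
Variable alpha : 'I_p -> int.
Implicit Types (Lambda : set R) (f : R -> R[i]) (i : 'I_p).

Definition left_end i : R := (alpha i)%:~R / p%:R.
Definition right_end i : R := ((alpha i)%:~R + 1) / p%:R.

Definition Omega_ : set R :=
  \bigcup_(i in [set: 'I_p]) [set` `]left_end i, right_end i[].

(* "f' in L^2" : the a.e. defined derivative agrees a.e. with an element of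
   L^2. *)
Definition Dmax f : Prop :=
  [/\ L2 Omega_ f,
      forall i, abs_continuous (left_end i) (right_end i) f &
      exists2 g, L2 Omega_ g &
        {ae @lebesgue_measure R, forall x, Omega_ x -> has_derivative f x (g x)}].

(* For f in Dmax these one-sided limits exist. *)
Definition f_left f : 'cV[R[i]]_p := \col_i lim_right f (left_end i).
Definition f_right f : 'cV[R[i]]_p := \col_i lim_left f (right_end i).

(* The domain of A consists of classes modulo a.e. equality; the boundary
   values are those of the absolutely continuous representative f0. *)
Definition spectral_unitary_matrix Lambda (B : 'M[R[i]]_p) : Prop :=
  B \is unitarymx /\
  forall f, L2 Omega_ f ->
    (diag_domain Omega_ Lambda f <->
     exists f0, [/\ aeeq Omega_ f f0, Dmax f0 & B *m f_left f0 = f_right f0]).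

Definition M_ (lambda : 'I_p -> R) : 'M[R[i]]_p :=
  ((Num.sqrt p%:R)^-1)%:C%C *:
  \matrix_(i, j) e2pi (p%:R^-1 * (alpha i)%:~R * lambda j).

Definition D_ (lambda : 'I_p -> R) : 'M[R[i]]_p :=
  diag_mx (\row_j e2pi (p%:R^-1 * lambda j)).

(* (f(x + alpha_0/p), ..., f(x + alpha_{p-1}/p)) *)
Definition sample f (x : R) : 'cV[R[i]]_p :=
  \col_i f (x + (alpha i)%:~R / p%:R).

End UnionOfIntervals.

Arguments Omega_ R {p} alpha.

(* Main.v *)
(** On a sample vector (f(x + alpha_i/p))_i the exponential of frequency
    lambda_j + p k is a scalar multiple of the j-th column of [M_].  Hence [M_] is
    invertible: a row vector killing its columns kills the samples of the whole
    spectrum, so by density those of indicators of single intervals.  The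
    exponentials lie in the domain of A, and their absolutely continuous
    representatives are the exponentials themselves, so the boundary condition
    makes the columns of [M_] eigenvectors of B for the eigenvalues
    exp(2 pi i lambda_j / p).  These are distinct since [M_] is invertible and its
    columns depend on them alone; as B is unitary the columns are orthonormal,
    which gives B = M D M^*.  The formula for U(t) is then an identity on the
    exponentials; both of its sides are bounded on L^2, so it extends by density. *)
From mathcomp Require Import measurable_realfun ring lra.
Require Import Defs.

Local Open Scope classical_set_scope.
Local Open Scope ring_scope.

(** * Complex modulus and exponentials *)

Section ComplexExponential.
Set Implicit Arguments.
Unset Strict Implicit.
Context {R : realType}.
Implicit Types (x y : R) (z w : R[i]).

Lemma modulus_sqr z : modulus z ^+ 2 = complex.Re z ^+ 2 + complex.Im z ^+ 2.
Proof. by case: z => a b; rewrite /modulus /= sqr_sqrtr // addr_ge0 ?sqr_ge0. Qed.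

Lemma ReD z w : complex.Re (z + w) = complex.Re z + complex.Re w.
Proof. by case: z w => a b [c d]. Qed.

Lemma ImD z w : complex.Im (z + w) = complex.Im z + complex.Im w.
Proof. by case: z w => a b [c d]. Qed.

Lemma ReM z w :
  complex.Re (z * w) = complex.Re z * complex.Re w - complex.Im z * complex.Im w.
Proof. by case: z w => a b [c d]. Qed.

Lemma ImM z w :
  complex.Im (z * w) = complex.Re z * complex.Im w + complex.Im z * complex.Re w.
Proof. by case: z w => a b [c d]. Qed.

Lemma modulus_sqrM z w : modulus (z * w) ^+ 2 = modulus z ^+ 2 * modulus w ^+ 2.
Proof. by rewrite !modulus_sqr ReM ImM; ring. Qed.

(** By the parallelogram law the two sides differ by [modulus (z - w) ^+ 2]. *)
Lemma modulus_sqrD_le z w :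
  modulus (z + w) ^+ 2 <= 2 * modulus z ^+ 2 + 2 * modulus w ^+ 2.
Proof.
rewrite !modulus_sqr ReD ImD -subr_ge0.
rewrite (_ : _ - _ = (complex.Re z - complex.Re w) ^+ 2 +
                     (complex.Im z - complex.Im w) ^+ 2); last by ring.
by rewrite addr_ge0 ?sqr_ge0.
Qed.

(** Iterates the two-term bound; a crude constant is enough because only its independence of the
    values [F i] matters. *)
Lemma modulus_sqr_sum_le (I : Type) (s : seq I) (F : I -> R[i]) :
  modulus (\sum_(i <- s) F i) ^+ 2 <=
  2 ^+ size s * \sum_(i <- s) modulus (F i) ^+ 2.
Proof.
elim: s => [|i s IH]; first by rewrite !big_nil mulr0 modulus_sqr /= expr0n addr0.
rewrite !big_cons (le_trans (modulus_sqrD_le _ _))//= -mulrDr [2 ^+ _.+1]exprS.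
rewrite -mulrA ler_pM2l// mulrDr lerD// ler_peMl ?sqr_ge0//.
by rewrite exprn_ege1// ler1n.
Qed.

Lemma modulus_sqr_eq0 z : (modulus z ^+ 2 == 0) = (z == 0).
Proof.
rewrite modulus_sqr paddr_eq0 ?sqr_ge0// !sqrf_eq0.
by case: z => a b; rewrite eq_complex.
Qed.

Lemma e2pi0 : e2pi (0 : R) = 1.
Proof. by rewrite /e2pi mulr0 cos0 sin0. Qed.

Lemma e2piD x y : e2pi (x + y) = e2pi x * e2pi y.
Proof.
rewrite /e2pi mulrDr cosD sinD; apply/eqP; rewrite eq_complex /= eqxx /=.
by apply/eqP; ring.
Qed.

Lemma e2pi_neq0 x : e2pi x != 0.
Proof.
apply/eqP => e0; have := e2piD x (- x).
by rewrite subrr e2pi0 e0 mul0r => /eqP; rewrite oner_eq0.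
Qed.

Lemma conj_e2pi x : (e2pi x)^* = e2pi (- x).
Proof. by rewrite /e2pi mulrN cosN sinN. Qed.

Lemma e2piN x : e2pi (- x) = (e2pi x)^-1.
Proof.
apply: (mulfI (e2pi_neq0 x)); rewrite divff ?e2pi_neq0//.
by rewrite -e2piD subrr e2pi0.
Qed.

Lemma e2piMz x (k : int) : e2pi (x * k%:~R) = e2pi x ^ k.
Proof.
have nat_case n : e2pi (x * n%:R) = e2pi x ^+ n.
  by elim: n => [|n IH]; rewrite ?mulr0 ?e2pi0// -natr1 mulrDr mulr1 e2piD IH exprSr.
case: k => n; first exact: nat_case.
by rewrite NegzE mulrNz mulrN e2piN -pmulrn nat_case -exprnN.
Qed.

Lemma e2pi_int (k : int) : e2pi (k%:~R : R) = 1.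
Proof.
rewrite -[k%:~R]mul1r e2piMz /e2pi mulr1 mulr_natl cos2pi sin2pi.
exact: exp1rz.
Qed.

Lemma continuous_Re_expfun (l : R) : continuous (fun x => complex.Re (expfun l x)).
Proof.
move=> x; rewrite /expfun /e2pi /=.
apply: (@continuous_comp _ _ _ (fun x => 2 * pi * (l * x)) (@cos R)).
  by do 2 (apply: continuousM; first exact: cst_continuous); exact: cvg_id.
exact: continuous_cos.
Qed.

Lemma continuous_Im_expfun (l : R) : continuous (fun x => complex.Im (expfun l x)).
Proof.
move=> x; rewrite /expfun /e2pi /=.
apply: (@continuous_comp _ _ _ (fun x => 2 * pi * (l * x)) (@sin R)).
  by do 2 (apply: continuousM; first exact: cst_continuous); exact: cvg_id.
exact: continuous_sin.
Qed.

End ComplexExponential.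

(** * Squared L^2 norms and translations *)

Section SquareNorm.
Set Implicit Arguments.
Unset Strict Implicit.
Context {R : realType}.
Implicit Types (D E : set R) (f g : R -> R[i]).
Notation mu := (@lebesgue_measure R).

(** The square of [L2norm]: without the exponent 1/2, estimates reduce to monotonicity and
    additivity of the integral. *)
Definition sqnorm D f : \bar R := (\int[mu]_(x in D) (modulus (f x) ^+ 2)%:E)%E.

Definition cmeasurable D f : Prop :=
  measurable_fun D (fun x => complex.Re (f x)) /\
  measurable_fun D (fun x => complex.Im (f x)).

Lemma sqnorm_ge0 D f : (0 <= sqnorm D f)%E.
Proof. by apply: integral_ge0 => x _; rewrite lee_fin sqr_ge0. Qed.

Lemma L2P D f : L2 D f <-> cmeasurable D f /\ (sqnorm D f < +oo)%E.
Proof.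
split=> [[mr mi h]|[[mr mi] h]].
  by split=> //; apply: lty_poweRy h; rewrite invr_eq0 pnatr_eq0.
by split=> //; exact: poweR_lty.
Qed.

Lemma sqnorm_lt D f (e : R) : 0 < e -> (L2norm D f < e%:E)%E ->
  (sqnorm D f <= (e ^+ 2)%:E)%E.
Proof.
move=> e0; rewrite /L2norm -/(sqnorm D f).
have := sqnorm_ge0 D f; case: (sqnorm D f) => [r| |] //; last first.
  by move=> _; rewrite poweRyr ?invr_eq0 ?pnatr_eq0.
rewrite lee_fin poweR_EFin !lte_fin lee_fin => r0.
rewrite powR12_sqrt// => h.
by rewrite -[r]sqr_sqrtr// lerXn2r ?nnegrE ?sqrtr_ge0 1?ltW.
Qed.

Lemma cmeasurable_modulus_sqr D f : cmeasurable D f ->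
  measurable_fun D (EFin \o (fun x => modulus (f x) ^+ 2)).
Proof.
move=> [mr mi]; apply/measurable_EFinP.
under eq_fun do rewrite modulus_sqr.
by apply: measurable_funD; exact: measurable_funX.
Qed.

Lemma cmeasurableD D f g : cmeasurable D f -> cmeasurable D g ->
  cmeasurable D (fun x => f x + g x).
Proof.
move=> [mr mi] [nr ni]; split.
  by under eq_fun do rewrite ReD; exact: measurable_funD.
by under eq_fun do rewrite ImD; exact: measurable_funD.
Qed.

Lemma cmeasurableZ D (c : R[i]) f : cmeasurable D f ->
  cmeasurable D (fun x => c * f x).
Proof.
move=> [mr mi]; split.
  by under eq_fun do rewrite ReM;
    apply: measurable_funB; apply: measurable_funM => //; exact: measurable_cst.
by under eq_fun do rewrite ImM;
  apply: measurable_funD; apply: measurable_funM => //; exact: measurable_cst.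
Qed.

Lemma cmeasurable_cst D (c : R[i]) : cmeasurable D (fun=> c).
Proof. by split; exact: measurable_cst. Qed.

Lemma cmeasurable_sum D (I : Type) (s : seq I) (F : I -> R -> R[i]) :
  (forall i, cmeasurable D (F i)) ->
  cmeasurable D (fun x => \sum_(i <- s) F i x).
Proof.
move=> mF; elim: s => [|i s IH].
  by under eq_fun do rewrite big_nil; exact: cmeasurable_cst.
by under eq_fun do rewrite big_cons; exact: cmeasurableD.
Qed.

Lemma sqnormD_le D f g : measurable D -> cmeasurable D f -> cmeasurable D g ->
  (sqnorm D (fun x => f x + g x)%R <= 2%:E * sqnorm D f + 2%:E * sqnorm D g)%E.
Proof.
move=> mD mf mg; have m2 := cmeasurable_modulus_sqr.
rewrite /sqnorm -!ge0_integralZl_EFin//;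
  try by [exact: m2|move=> x _; rewrite lee_fin sqr_ge0].
rewrite -ge0_integralD//.
- apply: ge0_le_integral => //.
  + by move=> x _; rewrite lee_fin sqr_ge0.
  + by apply: m2; exact: cmeasurableD.
  + by apply: emeasurable_funD; apply: measurable_funeM; exact: m2.
  + by move=> x _; rewrite -!EFinM -EFinD lee_fin modulus_sqrD_le.
- by move=> x _; rewrite -EFinM lee_fin mulr_ge0 ?sqr_ge0.
- by apply: measurable_funeM; exact: m2.
- by move=> x _; rewrite -EFinM lee_fin mulr_ge0 ?sqr_ge0.
- by apply: measurable_funeM; exact: m2.
Qed.

Lemma sqnormZ D (c : R[i]) f : measurable D -> cmeasurable D f ->
  sqnorm D (fun x => c * f x) = ((modulus c ^+ 2)%:E * sqnorm D f)%E.
Proof.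
move=> mD mf; rewrite /sqnorm -ge0_integralZl_EFin ?sqr_ge0//.
- by apply: eq_integral => x _; rewrite modulus_sqrM EFinM.
- by move=> x _; rewrite lee_fin sqr_ge0.
- exact: cmeasurable_modulus_sqr.
Qed.

Lemma sqnorm_sum_le D (I : Type) (s : seq I) (F : I -> R -> R[i]) :
  measurable D -> (forall i, cmeasurable D (F i)) ->
  (sqnorm D (fun x => \sum_(i <- s) F i x)%R <=
   (2 ^+ size s)%:E * \sum_(i <- s) sqnorm D (F i))%E.
Proof.
move=> mD mF; have m2 := cmeasurable_modulus_sqr.
rewrite /sqnorm -ge0_integral_sum//; last 2 first.
- by move=> i; exact: m2.
- by move=> i x _; rewrite lee_fin sqr_ge0.
rewrite -ge0_integralZl_EFin//.
- apply: ge0_le_integral => //.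
  + by move=> x _; rewrite lee_fin sqr_ge0.
  + by apply: m2; exact: cmeasurable_sum.
  + by apply: measurable_funeM; apply: emeasurable_sum => i; exact: m2.
  + by move=> x _; rewrite sumEFin -EFinM lee_fin modulus_sqr_sum_le.
- by move=> x _; rewrite sumEFin lee_fin sumr_ge0// => i _; rewrite sqr_ge0.
- by apply: emeasurable_sum => i; exact: m2.
Qed.

Lemma sqnormS D E f : measurable D -> measurable E -> E `<=` D ->
  cmeasurable D f -> (sqnorm E f <= sqnorm D f)%E.
Proof.
move=> mD mE ED mf; apply: ge0_subset_integral => //.
  exact: cmeasurable_modulus_sqr.
by move=> x _; rewrite lee_fin sqr_ge0.
Qed.

Lemma L2_lin D (c : R[i]) f g : measurable D -> L2 D f -> L2 D g ->
  L2 D (fun x => c * f x + g x).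
Proof.
move=> mD /L2P[mf f2] /L2P[mg g2]; apply/L2P; split.
  by apply: cmeasurableD => //; exact: cmeasurableZ.
apply: le_lt_trans (sqnormD_le mD (cmeasurableZ c mf) mg) _.
rewrite sqnormZ// lte_add_pinfty// ?lte_mul_pinfty// ?mule_ge0 ?sqnorm_ge0//.
by rewrite lee_fin sqr_ge0.
Qed.

Lemma L2_0 D : measurable D -> L2 D (fun=> 0).
Proof.
move=> mD; apply/L2P; split; first exact: cmeasurable_cst.
rewrite /sqnorm (_ : modulus 0 = 0) ?expr0n ?integral0 ?ltry//.
by rewrite /modulus /= expr0n addr0 sqrtr0.
Qed.

Lemma L2_comb D (I : eqType) (s : seq I) (c : I -> R[i]) (F : I -> R -> R[i]) :
  measurable D -> (forall i, i \in s -> L2 D (F i)) ->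
  L2 D (fun x => \sum_(i <- s) c i * F i x).
Proof.
move=> mD; elim: s => [|i s IH] hF.
  by under eq_fun do rewrite big_nil; exact: L2_0.
under eq_fun do rewrite big_cons; apply: L2_lin => //.
  by apply: hF; rewrite mem_head.
by apply: IH => j js; apply: hF; rewrite in_cons js orbT.
Qed.

Definition translation (s : R) : measurableTypeR R -> measurableTypeR R :=
  fun x => x + s.

Lemma measurable_translation (s : R) : measurable_fun setT (translation s).
Proof. by apply: measurable_funD => //; exact: measurable_cst. Qed.

(** The pushforward is a measure agreeing with Lebesgue measure on half-open intervals, which
    determine it. *)
Lemma lebesgue_measure_translation (s : R) (A : set R) : measurable A ->
  pushforward mu (translation s) A = mu A.
Proof.
move=> mA; apply/esym.
have ms := @measurable_translation s.
pose nu := [the {measure set (measurableTypeR R) -> \bar R} of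
  pushforward mu (translation s)].
apply: (@lebesgue_measure_unique R (nu ms)) => //= _ [[a b]] _ <-.
rewrite /pushforward /translation /=.
rewrite (_ : _ @^-1` _ = [set` `]a - s, b - s]]).
  rewrite !lebesgue_measure_itv/= !lte_fin ltrBlDr subrK.
  by case: ifP => // _; rewrite -!EFinB; congr EFin; ring.
by apply/seteqP; split => x /=; rewrite !in_itv/= ltrBlDr lerBrDr.
Qed.

Lemma cmeasurable_translate D E (s : R) f : measurable D ->
  (forall x, E x -> D (x + s)) -> cmeasurable D f ->
  cmeasurable E (fun x => f (x + s)).
Proof.
move=> mD ED [mr mi].
have sub : [set x + s | x in E] `<=` D by move=> _ [x Ex <-]; exact: ED.
have mt : measurable_fun E (fun x : R => x + s).
  by apply: measurable_funS (@measurable_translation s).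
by split; [apply: (measurable_comp mD sub mr mt)|apply: (measurable_comp mD sub mi mt)].
Qed.

Lemma sqnorm_translate_le D E (s : R) f : measurable D -> measurable E ->
  (forall x, E x -> D (x + s)) -> cmeasurable D f ->
  (sqnorm E (fun x => f (x + s)%R) <= sqnorm D f)%E.
Proof.
move=> mD mE ED mf.
pose phi := translation s.
have mphi : measurable_fun setT phi := @measurable_translation s.
have mF : measurable_fun D (EFin \o (fun x => modulus (f x) ^+ 2)).
  exact: cmeasurable_modulus_sqr.
have mpre : measurable (phi @^-1` D) by rewrite -[X in measurable X]setTI; exact: mphi.
(* Change of variables turns the integral over [D] into one over the preimage of [D], which contains
   [E]. *)
have -> : sqnorm D f = sqnorm (phi @^-1` D) (fun x => f (x + s)).
  rewrite /sqnorm -(ge0_integral_pushforward mphi mu mD mF).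
    apply: eq_measure_integral => A mA _.
    by apply/esym; exact: lebesgue_measure_translation.
  by move=> y _; rewrite lee_fin sqr_ge0.
apply: sqnormS => //.
exact: (cmeasurable_translate mD).
Qed.

(* [C] depends on the weights only, so letting [f] tend to [0] in L^2 makes the
   left-hand side tend to [0]. *)
Lemma sqnorm_comb_translate_le (I : finType) (c : I -> R[i]) :
  exists2 C : R, 0 <= C &
  forall D E (s : I -> R) f, measurable D -> measurable E ->
  (forall i x, E x -> D (x + s i)) -> cmeasurable D f ->
  (sqnorm E (fun x => \sum_i c i * f (x + s i)%R)%R <= C%:E * sqnorm D f)%E.
Proof.
exists (2 ^+ size (index_enum I) * \sum_i modulus (c i) ^+ 2).
  by rewrite mulr_ge0 ?exprn_ge0// sumr_ge0// => i _; rewrite sqr_ge0.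
move=> D E s f mD mE ED mf.
have mt i : cmeasurable E (fun x => f (x + s i)).
  by apply: (cmeasurable_translate mD) => // x; exact: ED.
apply: le_trans (sqnorm_sum_le _ mE _) _ => [i|]; first exact: cmeasurableZ.
rewrite EFinM -muleA lee_wpmul2l ?lee_fin ?exprn_ge0//.
rewrite -sumEFin ge0_sume_distrl; last by move=> i _; rewrite lee_fin sqr_ge0.
apply: lee_sum => i _; rewrite sqnormZ// lee_wpmul2l ?lee_fin ?sqr_ge0//.
by apply: sqnorm_translate_le => // x; exact: ED.
Qed.

(** Letting [e] tend to 0 makes the squared norm vanish, and a nonnegative function with zero
    integral is zero almost everywhere. The bound has the shape that an L^2 approximation with error
    [e] produces. *)
Lemma sqnorm_small_ae0 E f (C : R) : measurable E -> cmeasurable E f -> 0 <= C ->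
  (forall e, 0 < e -> (sqnorm E f <= (C * e ^+ 2)%:E)%E) ->
  {ae mu, forall x, E x -> f x = 0}.
Proof.
move=> mE mf C0 small.
have s0 : sqnorm E f = 0%E.
  apply/eqP; rewrite eq_le sqnorm_ge0 andbT; apply/lee_addgt0Pr => e e0.
  (* With this choice the bound becomes C/(C+1) times [e]; adding 1 covers the case [C = 0]. *)
  rewrite add0e; apply: le_trans (small (Num.sqrt (e / (C + 1))) _) _.
    by rewrite sqrtr_gt0 divr_gt0// ltr_wpDl.
  rewrite sqr_sqrtr; last by rewrite divr_ge0 ?addr_ge0// ltW.
  rewrite lee_fin mulrCA.
  by rewrite ger_pMr// ler_pdivrMr ?ltr_wpDl// mul1r lerDl.
have /(ae_eq_integral_abs mu mE (cmeasurable_modulus_sqr mf)) :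
    (\int[mu]_(x in E) `|(modulus (f x) ^+ 2)%:E| = 0)%E.
  by rewrite -s0; apply: eq_integral => x _; rewrite gee0_abs// lee_fin sqr_ge0.
apply: filterS => x /[apply] -[] /eqP.
by rewrite modulus_sqr_eq0 => /eqP.
Qed.

End SquareNorm.

(** * Almost-everywhere equality and boundary values *)

#[local] Instance ae_lebesgue_filter {R : realType} :
  Filter (nbhs (almost_everywhere (@lebesgue_measure R))).
Proof. exact: ae_filter_ringOfSetsType. Qed.

Section AlmostEverywhere.
Context {R : realType}.
Set Implicit Arguments.
Unset Strict Implicit.
Notation mu := (@lebesgue_measure R).

(** A nonempty open interval has positive measure, so no null set contains it. *)
Lemma ae_itv_ex (a b : R) (P : R -> Prop) : a < b -> {ae mu, forall x, P x} ->
  exists2 x, a < x < b & P x.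
Proof.
move=> ab aeP; apply: contrapT => nex.
have : mu [set` `]a, b[] = 0%E.
  apply/negligibleP => //; apply: (negligibleS _ aeP) => x.
  by rewrite /= in_itv/= => xab Px; apply: nex; exists x.
rewrite lebesgue_measure_itv/= lte_fin ab -EFinB => -[] /eqP.
by rewrite subr_eq0 gt_eqF.
Qed.

Lemma ae_translate (s : R) (P : R -> Prop) : {ae mu, forall x, P x} ->
  {ae mu, forall x, P (x + s)}.
Proof.
move=> [N [mN N0 PN]]; exists (translation s @^-1` N); split.
- by rewrite -[X in measurable X]setTI; exact: measurable_translation.
- by rewrite -[LHS]/(pushforward mu (translation s) N) lebesgue_measure_translation.
- by move=> x Px; exact: PN.
Qed.

(** Just to the right of [u] there is a point [v] where the functions agree; from [u] to [v] each
    changes by less than [e / 2], so at [u] they differ by at most [e]. *)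
Lemma unif_continuous_ae_eq (a b : R) (g h : R -> R) :
  (forall e, 0 < e -> exists2 d, 0 < d &
     forall u v, a < u -> u <= v -> v < b -> v - u < d -> `|g v - g u| < e) ->
  continuous h -> {ae mu, forall x, a < x < b -> g x = h x} ->
  forall x, a < x < b -> g x = h x.
Proof.
move=> ug ch gh u /andP[au ub]; apply/eqP; rewrite -subr_eq0 -normr_le0.
apply/ler_addgt0Pr => e e0; rewrite add0r.
have e2 : 0 < e / 2 by rewrite divr_gt0.
have [d d0 hd] := ug _ e2.
have /cvgr_dist_lt/(_ _ e2) := ch u.
move=> /nbhs_ballP[r /= r0 hr].
have lt : u < Num.min b (Num.min (u + d) (u + r)).
  by rewrite !lt_min ub !ltrDl d0 r0.
have [v /andP[uv]] := ae_itv_ex lt gh.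
rewrite !lt_min => /and3P[vb vd vr] ghv.
have /hr/= : ball u r v by rewrite /ball/= distrC ger0_norm ?subr_ge0 1?ltW// ltrBlDl.
have := hd u v au (ltW uv) vb; rewrite ltrBlDl => /(_ vd).
rewrite ghv ?(lt_trans au)// (_ : g u - h u = (h v - h u) - (h v - g u)); last by ring.
move=> l1 l2; apply: le_trans (ler_normB _ _) _.
by rewrite distrC [e]splitr lerD// ltW.
Qed.

Lemma lim_right_eq (a b : R) (g h : R -> R) : a < b -> continuous h ->
  (forall x, a < x < b -> g x = h x) -> lim (g x @[x --> a^'+]) = h a.
Proof.
move=> ab ch gh; apply/cvg_lim => //.
apply: (cvg_trans _ (cvg_at_right_filter (ch a))).
apply: near_eq_cvg; near=> x; apply/esym/gh/andP; split; near: x.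
  exact: nbhs_right_gt.
exact: nbhs_right_lt.
Unshelve. all: by end_near. Qed.

Lemma lim_left_eq (a b : R) (g h : R -> R) : a < b -> continuous h ->
  (forall x, a < x < b -> g x = h x) -> lim (g x @[x --> b^'-]) = h b.
Proof.
move=> ab ch gh; apply/cvg_lim => //.
apply: (cvg_trans _ (cvg_at_left_filter (ch b))).
apply: near_eq_cvg; near=> x; apply/esym/gh/andP; split; near: x.
  exact: nbhs_left_gt.
exact: nbhs_left_lt.
Unshelve. all: by end_near. Qed.

Lemma normRe_le_modulus (z : R[i]) : `|complex.Re z| <= modulus z.
Proof.
case: z => a b; rewrite /modulus /= -sqrtr_sqr ler_wsqrtr//.
by rewrite lerDl sqr_ge0.
Qed.

Lemma normIm_le_modulus (z : R[i]) : `|complex.Im z| <= modulus z.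
Proof.
case: z => a b; rewrite /modulus /= -sqrtr_sqr ler_wsqrtr//.
by rewrite lerDr sqr_ge0.
Qed.

Lemma abs_continuous_unif (a b : R) (f : R -> R[i]) (e : R) :
  abs_continuous a b f -> 0 < e -> exists2 d, 0 < d &
    forall u v, a < u -> u <= v -> v < b -> v - u < d -> modulus (f v - f u) < e.
Proof.
move=> fac /fac[d d0 h]; exists d => // u v au uv vb vud.
have := h 1 (fun=> u) (fun=> v); rewrite !big_ord1; apply => //.
by move=> i j _ _; rewrite !ord1.
Qed.

(** Both sides are continuous on the interval, so they cannot differ on a null set only. This
    identifies the representative whose boundary values enter the condition on [B]. *)
Lemma abs_continuous_ae_expfun (a b l : R) (f : R -> R[i]) :
  abs_continuous a b f ->
  {ae mu, forall x, a < x < b -> f x = expfun l x} ->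
  forall x, a < x < b -> f x = expfun l x.
Proof.
move=> fac fl x xab.
have re : complex.Re (f x) = complex.Re (expfun l x).
  apply: (@unif_continuous_ae_eq a b (fun x => complex.Re (f x))
    (fun x => complex.Re (expfun l x))) xab => //.
  - move=> e /(abs_continuous_unif fac)[d d0 h]; exists d => // u v au uv vb vud.
    apply: le_lt_trans (h _ _ au uv vb vud).
    by apply: le_trans (normRe_le_modulus _); case: (f u) (f v) => ? ? [].
  - exact: continuous_Re_expfun.
  - by move: fl; apply: filterS => y /[apply] ->.
have im : complex.Im (f x) = complex.Im (expfun l x).
  apply: (@unif_continuous_ae_eq a b (fun x => complex.Im (f x))
    (fun x => complex.Im (expfun l x))) xab => //.
  - move=> e /(abs_continuous_unif fac)[d d0 h]; exists d => // u v au uv vb vud.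
    apply: le_lt_trans (h _ _ au uv vb vud).
    by apply: le_trans (normIm_le_modulus _); case: (f u) (f v) => ? ? [].
  - exact: continuous_Im_expfun.
  - by move: fl; apply: filterS => y /[apply] ->.
by case: (f x) re im => ? ? /= -> ->.
Qed.

Lemma abs_continuous_ae_expfun_lim_right (a b l : R) (f : R -> R[i]) : a < b ->
  abs_continuous a b f -> {ae mu, forall x, a < x < b -> f x = expfun l x} ->
  lim_right f a = expfun l a.
Proof.
move=> ab fac /(abs_continuous_ae_expfun fac) fl; rewrite /lim_right.
rewrite (@lim_right_eq a b _ (fun x => complex.Re (expfun l x)))//.
- rewrite (@lim_right_eq a b _ (fun x => complex.Im (expfun l x)))//.
    exact: continuous_Im_expfun.
  by move=> x /fl ->.
- exact: continuous_Re_expfun.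
- by move=> x /fl ->.
Qed.

Lemma abs_continuous_ae_expfun_lim_left (a b l : R) (f : R -> R[i]) : a < b ->
  abs_continuous a b f -> {ae mu, forall x, a < x < b -> f x = expfun l x} ->
  lim_left f b = expfun l b.
Proof.
move=> ab fac /(abs_continuous_ae_expfun fac) fl; rewrite /lim_left.
rewrite (@lim_left_eq a b _ (fun x => complex.Re (expfun l x)))//.
- rewrite (@lim_left_eq a b _ (fun x => complex.Im (expfun l x)))//.
    exact: continuous_Im_expfun.
  by move=> x /fl ->.
- exact: continuous_Re_expfun.
- by move=> x /fl ->.
Qed.

End AlmostEverywhere.

(** * Inner products and unitary operators *)

Section InnerProduct.
Context {R : realType}.
Set Implicit Arguments.
Unset Strict Implicit.
Notation mu := (@lebesgue_measure R).
Implicit Types (D : set R) (f g : R -> R[i]).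

Lemma inner_self D f : complex.Re (inner D f f) = fine (sqnorm D f).
Proof.
rewrite /inner /cintegral /= /Rintegral /sqnorm; congr fine.
apply: eq_integral => x _; rewrite modulus_sqr; case: (f x) => a b /=.
by rewrite mulrN opprK.
Qed.

Lemma unitary_sqnorm D T f : unitary_L2 D T -> L2 D f ->
  sqnorm D (T f) = sqnorm D f.
Proof.
move=> [TL _ _ Tin _] fL.
have /L2P[_ foo] := fL; have /L2P[_ Tfoo] := TL _ fL.
(* [fine] sends infinity to 0, so both squared norms must be finite before they can be compared
   through [inner]. *)
rewrite -[LHS]fineK ?ge0_fin_numE ?sqnorm_ge0// -[RHS]fineK ?ge0_fin_numE ?sqnorm_ge0//.
by rewrite -!inner_self Tin.
Qed.

Lemma unitary_comb D T (I : eqType) (s : seq I) (c d : I -> R[i])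
    (F : I -> R -> R[i]) : measurable D -> unitary_L2 D T ->
  (forall i, i \in s -> L2 D (F i)) ->
  (forall i, i \in s -> aeeq D (T (F i)) (fun x => d i * F i x)) ->
  aeeq D (T (fun x => \sum_(i <- s) c i * F i x))
         (fun x => \sum_(i <- s) c i * (d i * F i x)).
Proof.
move=> mD [_ _ Tlin _ _]; elim: s => [|i s IH] FL Fd.
  (* For the empty sum, linearity with [c = -1] and [f = g = 0] gives T 0 = - T 0 + T 0 = 0 almost
     everywhere on [D]. *)
  have T0 := Tlin (-1) _ _ (L2_0 mD) (L2_0 mD).
  rewrite (_ : (fun x => \sum_(_ <- _) _) = (fun=> -1 * 0 + 0)); last first.
    by apply/funext => x; rewrite big_nil mulr0 addr0.
  move: T0; apply: filterS => x /[apply] ->; rewrite big_nil mulN1r.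
  by rewrite addNr.
have sL j : j \in s -> L2 D (F j) by move=> js; apply: FL; rewrite in_cons js orbT.
have iL : L2 D (F i) by apply: FL; rewrite mem_head.
have Fs := IH sL (fun j js => Fd j (mem_behead (s := i :: s) js)).
have Ti := Fd i (mem_head i s).
have := Tlin (c i) _ _ iL (L2_comb c mD sL).
rewrite (_ : (fun x => \sum_(j <- i :: s) c j * F j x) =
             (fun x => c i * F i x + \sum_(j <- s) c j * F j x)); last first.
  by apply/funext => x; rewrite big_cons.
move: Fs Ti; apply: filterS3 => x Fs Ti Tl Dx.
by rewrite (Tl Dx) (Fs Dx) (Ti Dx) big_cons.
Qed.

Lemma mul_conj_expfun (l m x : R) :
  expfun l x * (expfun m x)^* = expfun (l - m) x.
Proof. by rewrite /expfun conj_e2pi -e2piD -mulNr mulrDl. Qed.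

Lemma inner_expfun D (l m : R) :
  inner D (expfun l) (expfun m) = cintegral D (expfun (l - m)).
Proof. by rewrite /inner; congr cintegral; apply/funext => x; exact: mul_conj_expfun. Qed.

(** On a set of finite measure the bounded real and imaginary parts are integrable, so the real
    constant leaves both integrals. *)
Lemma inner_expfunZ D (c l m : R) : measurable D -> (mu D < +oo)%E ->
  inner D (fun x => c%:C%C * expfun l x) (expfun m) =
  c%:C%C * inner D (expfun l) (expfun m).
Proof.
move=> mD Doo; rewrite inner_expfun /inner /cintegral.
rewrite (_ : (fun x => complex.Re _) = (fun x => c * complex.Re (expfun (l - m) x))).
  rewrite (_ : (fun x => complex.Im _) = (fun x => c * complex.Im (expfun (l - m) x))).
    rewrite !RintegralZl//.
    - by apply/eqP; rewrite eq_complex /= !mul0r subr0 addr0 !eqxx.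
    - apply: measurable_bounded_integrable => //.
        apply: measurable_funTS; apply: continuous_measurable_fun.
        exact: continuous_Im_expfun.
      exists 1; split => // M M1 x _ /=.
      by apply: le_trans (sin_max _) (ltW M1).
    - apply: measurable_bounded_integrable => //.
        apply: measurable_funTS; apply: continuous_measurable_fun.
        exact: continuous_Re_expfun.
      exists 1; split => // M M1 x _ /=.
      by apply: le_trans (cos_max _) (ltW M1).
  by apply/funext => x; rewrite -mulrA mul_conj_expfun ImM /= mul0r addr0.
by apply/funext => x; rewrite -mulrA mul_conj_expfun ReM /= mul0r subr0.
Qed.

End InnerProduct.

(** * Integer powers of a matrix on an eigenvector *)

Section EigenvectorPowers.
Set Implicit Arguments.
Unset Strict Implicit.

Lemma exprz_mulmx_eigen (F : fieldType) (n : nat) (B : 'M[F]_n.+1) (d : F)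
    (v : 'cV[F]_n.+1) (c : int) :
  B \is a GRing.unit -> d != 0 -> B *m v = d *: v -> B ^ c *m v = d ^ c *: v.
Proof.
move=> Bu d0 Bv.
have nat_case (A : 'M[F]_n.+1) (e : F) m :
    A *m v = e *: v -> A ^+ m *m v = e ^+ m *: v.
  move=> Av; elim: m => [|m IH]; first by rewrite !expr0 mul1mx scale1r.
  by rewrite [A ^+ _]exprS [e ^+ _]exprSr -mulmxA IH -scalemxAr Av scalerA.
case: c => m; first exact: nat_case.
(* Negative powers are powers of the inverse, which has [v] as an eigenvector for [d^-1]. *)
rewrite NegzE -!exprz_inv -!exprnP; apply: nat_case.
have : B^-1 *m (B *m v) = v by rewrite mulmxA [B^-1 *m B](mulVr Bu) mul1mx.
rewrite Bv -scalemxAr => dBv.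
by apply: (scalerI d0); rewrite dBv scalerA divff// scale1r.
Qed.

End EigenvectorPowers.

(** * Diagonalisation of a unitary matrix with distinct eigenvalues *)

Section UnitaryDiagonalisation.
Set Implicit Arguments.
Unset Strict Implicit.
Local Open Scope sesquilinear_scope.

(** Eigenvectors of a unitary matrix for distinct eigenvalues are orthogonal; with unit columns [M]
    is therefore unitary, and the eigenvector equation can be solved for [B]. *)
Lemma unitary_eigenmatrix (C : numClosedFieldType) (n : nat) (B M : 'M[C]_n)
    (d : 'rV[C]_n) :
  B \is unitarymx -> B *m M = M *m diag_mx d ->
  (forall j, `|d 0 j| = 1) -> injective (d 0) ->
  (forall j, (M^t* *m M) j j = 1) ->
  B = M *m diag_mx d *m M^t*.
Proof.
move=> Bu BM d1 dinj Mjj.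
have BtB : B^t* *m B = 1%:M by apply: mulmx1C; exact/unitarymxP.
(* Unitarity of [B] allows it to be inserted into the Gram matrix of the columns, where [BM] trades
   it for the diagonal factors. *)
have G : M^t* *m M = (diag_mx d)^t* *m (M^t* *m M) *m diag_mx d.
  have {1}<- : (M *m diag_mx d)^t* *m (M *m diag_mx d) = M^t* *m M.
    by rewrite -BM trmx_mul map_mxM -!mulmxA [B^t* *m (B *m M)]mulmxA BtB mul1mx.
  by rewrite trmx_mul map_mxM !mulmxA.
have M1 : M^t* *m M = 1%:M.
  move: (M^t* *m M) G Mjj => A G Ajj.
  apply/matrixP => j k; rewrite [RHS]mxE; have [->|jk] := eqVneq j k; first exact: Ajj.
  move: (congr1 (fun X : 'M[C]_n => X j k) G) => /=.
  rewrite tr_diag_mx map_diag_mx mul_diag_mx mul_mx_diag !mxE /= => e.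
  (* If the entry [A j k] is nonzero it cancels from the [(j, k)] entry of [G], leaving
     [(d 0 j)^* * d 0 k = 1]; as [d 0 j] has modulus 1, this means [d 0 j = d 0 k]. *)
  apply/eqP/negPn/negP => s0.
  have : (d 0 j)^* * d 0 k = 1.
    by apply: (mulIf s0); rewrite mul1r [RHS]e; ring.
  move=> /(congr1 (fun z => d 0 j * z)); rewrite mulrA -normCK d1 expr1n mul1r mulr1.
  by move=> /dinj kj; rewrite kj eqxx in jk.
by rewrite -BM -mulmxA (mulmx1C M1) mulmx1.
Qed.

End UnitaryDiagonalisation.

(** * Samples of exponentials over the intervals *)

Section UnionOfTranslates.
Set Implicit Arguments.
Unset Strict Implicit.
Context {R : realType} {n : nat} (alpha : 'I_n.+1 -> int) (lambda : 'I_n.+1 -> R).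
Notation mu := (@lebesgue_measure R).
Notation P := (n.+1%:R : R).
Notation Omega := (Omega_ R alpha).
Implicit Types (x : R) (i j : 'I_n.+1) (k : int).

Lemma natrS_gt0 : 0 < P. Proof. by rewrite ltr0n. Qed.

Lemma natrS_neq0 : P != 0. Proof. by rewrite gt_eqF ?natrS_gt0. Qed.

Lemma measurable_Omega : measurable Omega.
Proof. by apply: fin_bigcup_measurable => // i _; exact: measurable_itv. Qed.

Lemma right_endE i : right_end alpha i = left_end alpha i + P^-1 :> R.
Proof. by rewrite /right_end mulrDl mul1r. Qed.

Lemma left_lt_right i : left_end alpha i < right_end alpha i :> R.
Proof. by rewrite right_endE ltrDl invr_gt0 natrS_gt0. Qed.

Lemma Omega_translate i x : 0 < x < P^-1 -> Omega (x + (alpha i)%:~R / P).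
Proof.
move=> /andP[x0 x1]; exists i => //=; rewrite in_itv/= right_endE /left_end.
by rewrite ltrDr x0 addrC ltrD2l.
Qed.

(** Because [alpha i] is an integer, column [j] of [M_] depends on [lambda j] only through a phase;
    hence equal phases give equal columns. *)
Lemma e2pi_phase i j : e2pi (P^-1 * (alpha i)%:~R * lambda j) =
  e2pi (P^-1 * lambda j) ^ alpha i.
Proof. by rewrite -e2piMz; congr e2pi; ring. Qed.

(** The shift adds to the phase [lambda j * alpha i / P] and the integer [k * alpha i], which [e2pi]
    does not see. *)
Lemma expfun_translate i j k x :
  expfun (lambda j + P * k%:~R) (x + (alpha i)%:~R / P) =
  expfun (lambda j + P * k%:~R) x * e2pi (P^-1 * (alpha i)%:~R * lambda j).
Proof.
rewrite /expfun -[LHS]mulr1 -[in RHS](mulr1 (e2pi _)) -{1}(e2pi_int (- (k * alpha i))).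
rewrite mulr1 -!e2piD; congr e2pi; rewrite mulrNz intrM.
by field; rewrite nat1r; exact: natrS_neq0.
Qed.

Lemma sqrtP_neq0 : (Num.sqrt P)%:C%C != 0 :> R[i].
Proof. by rewrite eq_complex /= eqxx andbT gt_eqF// sqrtr_gt0 natrS_gt0. Qed.

Lemma sqrtPV : ((Num.sqrt P)^-1)%:C%C = ((Num.sqrt P)%:C%C)^-1 :> R[i].
Proof. exact: fmorphV. Qed.

(** The scalar absorbs all dependence on [k] and [x]; [Num.sqrt P] undoes the normalisation of
    [M_]. *)
Lemma sample_expfun j k x :
  sample alpha (expfun (lambda j + P * k%:~R)) x =
  (expfun (lambda j + P * k%:~R) x * (Num.sqrt P)%:C%C) *: col j (M_ alpha lambda).
Proof.
apply/matrixP => i z; rewrite !mxE expfun_translate -!mulrA sqrtPV.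
by rewrite mulrA mulrA mulrA -[_ * _ * _^-1]mulrA divff ?sqrtP_neq0// mulr1.
Qed.

End UnionOfTranslates.

(** * Invertibility of [M_] and diagonalisation of [B] *)

Section SpectralMatrix.
Set Implicit Arguments.
Unset Strict Implicit.
Local Open Scope sesquilinear_scope.
Context {R : realType} {n : nat} (alpha : 'I_n.+1 -> int) (lambda : 'I_n.+1 -> R)
  (Lambda : set R).
Notation mu := (@lebesgue_measure R).
Notation P := (n.+1%:R : R).
Notation Omega := (Omega_ R alpha).
Implicit Types (x : R) (i j : 'I_n.+1) (k : int).

Lemma norm_e2pi x : `|e2pi x| = 1.
Proof.
apply/eqP; rewrite -(@pexpr_eq1 _ _ 2)// normCK conj_e2pi -e2piD subrr.
by rewrite e2pi0.
Qed.

(** Each of the [n.+1] entries of a column has squared modulus [P^-1]. Orthogonality of different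
    columns comes later, from [B]. *)
Lemma adj_M_diag j : ((M_ alpha lambda)^t* *m M_ alpha lambda) j j = 1.
Proof.
rewrite !mxE; under eq_bigr => i _.
  rewrite !mxE mulrC -normCK normrM norm_e2pi mulr1.
  over.
rewrite sumr_const card_ord normc_def /= expr0n addr0 sqrtr_sqr.
rewrite ger0_norm ?invr_ge0 ?sqrtr_ge0// -rmorphXn /= exprVn sqr_sqrtr// -rmorphMn /=.
by rewrite -mulr_natl divff ?natrS_neq0.
Qed.

Context (alpha_incr : forall i j, (i < j)%N -> alpha i < alpha j).
Context (mu_Omega : mu Omega = 1%E).
Context (spec : has_spectrum Omega Lambda).
Context (LambdaE :
  Lambda = [set lambda j + P * k%:~R | j in [set: 'I_n.+1] & k in [set: int]]).

(** Distinct integers differ by at least 1, so left ends are at least [P^-1] apart and the intervals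
    do not overlap. *)
Lemma translate_in_interval i j x : 0 < x < P^-1 ->
  (left_end alpha j < x + (alpha i)%:~R / P < right_end alpha j) = (i == j).
Proof.
move=> /andP[x0 x1].
have Vgt0 : 0 < P^-1 by rewrite invr_gt0 natrS_gt0.
have sep i1 i2 : (i1 < i2)%N ->
    ((alpha i1)%:~R / P : R) + P^-1 <= (alpha i2)%:~R / P.
  move=> /alpha_incr; rewrite -lezD1 -(ler_int R) intrD => h.
  by rewrite -[X in _ + X]mul1r -mulrDl ler_pM2r.
have [<-|ij] := eqVneq i j.
  by rewrite right_endE /left_end ltrDr x0 addrC ltrD2l x1.
rewrite right_endE /left_end; apply/negbTE/negP => /andP[h1 h2].
have := sep i j; have := sep j i; move: h1 h2 x0 x1 Vgt0.
move: ((alpha i)%:~R / P) ((alpha j)%:~R / P) (P^-1) => a b v h1 h2 x0 x1 v0.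
case: (ltngtP i j) => [_ _ /(_ isT) ?|_ /(_ isT) ?|/val_inj/eqP]; [lra|lra|].
by rewrite (negbTE ij).
Qed.

Lemma spectrum_expfun : orthonormal_basis Omega Lambda expfun.
Proof.
suff <- : (fun l x => ((Num.sqrt (fine (mu Omega)))^-1)%:C%C * expfun l x) =
  @expfun R by exact: spec.
by apply/funext => l; apply/funext => x; rewrite mu_Omega /= sqrtr1 invr1 mul1r.
Qed.

Lemma L2_expfun l : Lambda l -> L2 Omega (expfun l).
Proof. by have [+ _ _] := spectrum_expfun; exact. Qed.

Lemma expfun_approx f (e : R) : L2 Omega f -> 0 < e ->
  exists (s : seq R) (c : R -> R[i]), (forall l, l \in s -> Lambda l) /\
    (sqnorm Omega (fun x => f x - \sum_(l <- s) c l * expfun l x)%R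
       <= (e ^+ 2)%:E)%E.
Proof.
move=> fL e0; have [_ _ /(_ _ fL _ e0)[s [c [sL h]]]] := spectrum_expfun.
by exists s, c; split => //; exact: sqnorm_lt.
Qed.

Lemma L2_expfun_diff f (s : seq R) (c : R -> R[i]) : L2 Omega f ->
  (forall l, l \in s -> Lambda l) ->
  L2 Omega (fun x => f x - \sum_(l <- s) c l * expfun l x).
Proof.
move=> fL sL; have mO := measurable_Omega (R := R) alpha.
rewrite (_ : (fun x => _) =
  (fun x => -1 * (\sum_(l <- s) c l * expfun l x) + f x)); last first.
  by apply/funext => x; rewrite mulN1r addrC.
by apply: L2_lin => //; apply: L2_comb => // l /sL; exact: L2_expfun.
Qed.

Lemma row_sample (w : 'rV[R[i]]_n.+1) f x :
  (w *m sample alpha f x) 0 0 = \sum_i w 0 i * f (x + (alpha i)%:~R / P).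
Proof. by rewrite mxE; apply: eq_bigr => i _; rewrite !mxE. Qed.

Lemma Lambda_sample l x : Lambda l ->
  exists (a : R[i]) j, sample alpha (expfun l) x = a *: col j (M_ alpha lambda).
Proof.
by rewrite LambdaE => -[j _ [k _ <-]]; rewrite sample_expfun; do 2 eexists.
Qed.

Lemma L2_indic (A : set R) : measurable A -> L2 Omega (fun x => (\1_A x)%:C%C).
Proof.
move=> mA; have mO := measurable_Omega (R := R) alpha.
have mi : cmeasurable Omega (fun x => (\1_A x)%:C%C).
  by split => /=; [exact: measurable_indic|exact: measurable_cst].
apply/L2P; split => //.
apply: (@le_lt_trans _ _ (\int[mu]_(x in Omega) (1 : R)%:E)%E); last first.
  rewrite integral_cst//; apply: lte_mul_pinfty => //.
  by move: mu_Omega => /= ->; exact: ltry.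
apply: ge0_le_integral => //.
- by move=> x _; rewrite lee_fin sqr_ge0.
- exact: cmeasurable_modulus_sqr.
- move=> x _; rewrite lee_fin modulus_sqr /= expr0n addr0 indicE.
  by case: (_ \in _); rewrite ?expr1n ?expr0n.
Qed.

Lemma M_unit : M_ alpha lambda \in unitmx.
Proof.
have mO := measurable_Omega (R := R) alpha.
rewrite unitmxE unitfE; apply/negP => /det0P[w w0 wM].
have [i0 wi0] : exists i0, w 0 i0 != 0.
  apply/existsP; apply: contra_neqT w0 => /existsPn w0.
  by apply/rowP => i; rewrite mxE; apply/eqP; move: (w0 i); rewrite negbK.
have [C C0 hC] := sqnorm_comb_translate_le (fun i => w 0 i).
(* For [x] in [E] below, the sample of this indicator is the [i0]-th unit vector, so [w] maps it to
   [w 0 i0]. *)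
pose f x : R[i] := (\1_([set` `]left_end alpha i0, right_end alpha i0[]) x)%:C%C.
have fL : L2 Omega f by apply: L2_indic; exact: measurable_itv.
pose E : set R := [set` `]0, P^-1[].
have w0ae : {ae mu, forall x, E x -> w 0 i0 = 0}.
  apply: (@sqnorm_small_ae0 _ E (fun=> w 0 i0) C) => //.
    exact: measurable_itv.
  move=> e e0; have [s [c [sL fs]]] := expfun_approx fL e0.
  pose g x := f x - \sum_(l <- s) c l * expfun l x.
  have /L2P[mg _] : L2 Omega g by exact: L2_expfun_diff.
  (* Replacing [f] by the approximation error [g] changes nothing, since [w] annihilates the samples
     of exponentials from [Lambda]. *)
  have -> : sqnorm E (fun=> w 0 i0) =
      sqnorm E (fun x => \sum_i w 0 i * g (x + (alpha i)%:~R / P)).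
    apply: eq_integral => x; rewrite inE /E /= in_itv /= => xE.
    congr ((modulus _ ^+ 2)%:E); rewrite -row_sample.
    have -> : sample alpha g x = sample alpha f x -
        \sum_(l <- s) c l *: sample alpha (expfun l) x.
      apply/matrixP => i z; rewrite !mxE summxE; congr (_ - _).
      by apply: eq_bigr => l _; rewrite !mxE.
    rewrite mulmxBr mulmx_sumr big_seq big1 ?subr0; last first.
      move=> l /sL /(@Lambda_sample _ x)[a [j ->]].
      by rewrite -!scalemxAr colE mulmxA wM mul0mx !scaler0.
    have fE i : f (x + (alpha i)%:~R / P) = (i == i0)%:R.
      rewrite /f indicE mem_setE in_itv/= translate_in_interval//.
      by case: (i == i0).
    rewrite row_sample (bigD1 i0)//= big1 ?addr0 => [|i ii0]; rewrite fE.
      by rewrite eqxx mulr1.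
    by rewrite (negbTE ii0) mulr0.
  apply: le_trans (hC _ _ _ _ mO _ _ mg) _ => //.
  - exact: measurable_itv.
  - by move=> i x; rewrite /E /= in_itv /= => /Omega_translate; exact.
  - by rewrite EFinM lee_wpmul2l// lee_fin.
have V0 : 0 < P^-1 by rewrite invr_gt0 natrS_gt0.
have [x xE] := ae_itv_ex V0 w0ae.
by rewrite /E /= in_itv/= => /(_ xE) /eqP; rewrite (negbTE wi0).
Qed.

Lemma phase_inj : injective (fun j => e2pi (P^-1 * lambda j)).
Proof.
move=> j k /= jk.
have : col j (M_ alpha lambda) = col k (M_ alpha lambda).
  by apply/matrixP => i z; rewrite !mxE !e2pi_phase jk.
(* The inverse of [M_] turns equal columns into equal unit vectors, whose [j]-th entries differ
   unless [j = k]. *)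
rewrite !colE => /(congr1 (fun A => invmx (M_ alpha lambda) *m A)).
rewrite !mulKmx ?M_unit// => /(congr1 (fun A : 'cV[R[i]]_n.+1 => A j 0)).
by rewrite !mxE !eqxx /= andbT; case: eqVneq => // _ /eqP; rewrite oner_eq0.
Qed.

Lemma diag_domain_expfun l : Lambda l -> diag_domain Omega Lambda (expfun l).
Proof.
have mO := measurable_Omega (R := R) alpha.
have mOoo : (mu Omega < +oo)%E by rewrite mu_Omega ltry.
move=> Ll; have [_ ortho _] := spectrum_expfun.
exists (fun x => l%:C%C * expfun l x); split.
- exact: L2_expfun.
- have := L2_lin l%:C%C mO (L2_expfun Ll) (L2_0 mO).
  by congr L2; apply/funext => x; rewrite addr0.
(* By orthonormality both sides are a frequency times a Kronecker symbol, so they can only differ at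
   [l = m], where the frequencies coincide. *)
- move=> m Lm; rewrite inner_expfunZ// ortho//.
  by have [->//|] := eqVneq l m; rewrite !mulr0.
Qed.

Context (B : 'M[R[i]]_n.+1).
Context (specB : spectral_unitary_matrix alpha Lambda B).

Lemma B_eigen j : B *m col j (M_ alpha lambda) =
  e2pi (P^-1 * lambda j) *: col j (M_ alpha lambda).
Proof.
have Ll : Lambda (lambda j + P * 0%:~R) by rewrite LambdaE; exists j => //; exists 0.
have [_ domB] := specB.
have [/(_ (diag_domain_expfun Ll))[f0 [ef0 [_ fac _] Bf]] _] := domB _ (L2_expfun Ll).
have ef i : {ae mu, forall x, left_end alpha i < x < right_end alpha i ->
    f0 x = expfun (lambda j + P * 0%:~R) x}.
  move: ef0; apply: filterS => x h xi; rewrite h//.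
  by exists i => //=; rewrite in_itv.
(* Left ends are the translates of 0 and right ends those of [P^-1], so both boundary vectors are
   samples of one exponential, hence multiples of one column. *)
have fl : f_left alpha f0 = sample alpha (expfun (lambda j + P * 0%:~R)) 0.
  apply/matrixP => i z; rewrite !mxE add0r.
  exact: (abs_continuous_ae_expfun_lim_right (left_lt_right alpha i) (fac i) (ef i)).
have fr : f_right alpha f0 = sample alpha (expfun (lambda j + P * 0%:~R)) P^-1.
  apply/matrixP => i z; rewrite !mxE.
  rewrite (abs_continuous_ae_expfun_lim_left (left_lt_right alpha i) (fac i) (ef i)).
  by rewrite right_endE [P^-1 + _]addrC.
move: Bf; rewrite fl fr !sample_expfun -scalemxAr.
rewrite {1 2}/expfun mulr0 e2pi0 mul1r mulrC -scalerA.
move=> /(scalerI (sqrtP_neq0 (R := R) (n := n))) ->; congr (e2pi _ *: _).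
by rewrite mulr0 addr0 mulrC.
Qed.

Lemma B_diagonalisation : B = M_ alpha lambda *m D_ lambda *m
  (M_ alpha lambda)^t*.
Proof.
have [Bu _] := specB; apply: unitary_eigenmatrix => //.
- apply/matrixP => i j; rewrite mul_mx_diag !mxE.
  have := congr1 (fun A : 'cV[R[i]]_n.+1 => A i 0) (B_eigen j).
  rewrite !mxE => e; rewrite mulrC -e.
  by apply: eq_bigr => k _; rewrite !mxE.
- by move=> j; rewrite mxE norm_e2pi.
- by move=> j k; rewrite !mxE; exact: phase_inj.
- exact: adj_M_diag.
Qed.

End SpectralMatrix.

(** * The formula for [U t]: exponentials, then density *)

Section LocalTranslations.
Set Implicit Arguments.
Unset Strict Implicit.
Context {R : realType} {n : nat} (alpha : 'I_n.+1 -> int) (lambda : 'I_n.+1 -> R)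
  (Lambda : set R).
Notation mu := (@lebesgue_measure R).
Notation P := (n.+1%:R : R).
Notation Omega := (Omega_ R alpha).
Implicit Types (x : R) (i j : 'I_n.+1) (k : int).

Context (mu_Omega : mu Omega = 1%E).
Context (spec : has_spectrum Omega Lambda).
Context (LambdaE :
  Lambda = [set lambda j + P * k%:~R | j in [set: 'I_n.+1] & k in [set: int]]).
Context (B : 'M[R[i]]_n.+1) (specB : spectral_unitary_matrix alpha Lambda B).

(** The sample is an eigenvector of [B], so [B ^ c] contributes the phase [lambda j * c / P]; this
    compensates the shift by [c / P] up to the integer [k * c]. *)
Lemma expfun_local_translation l (t x : R) (c : int) : Lambda l ->
  e2pi (l * t) *: sample alpha (expfun l) x =
  B ^ c *m sample alpha (expfun l) (x + t - c%:~R / P).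
Proof.
have Bu : B \is a GRing.unit by have [/unitarymx_unit] := specB.
rewrite {1}LambdaE => -[j _ [k _ <-]]; rewrite !sample_expfun -scalemxAr.
rewrite (exprz_mulmx_eigen c Bu (e2pi_neq0 _)
  (B_eigen mu_Omega spec LambdaE specB j)).
rewrite !scalerA !mulrA [in RHS]mulrAC; congr (_ * _ *: _).
rewrite -e2piMz /expfun -!e2piD -[LHS]mulr1 -(e2pi_int (- (k * c))) -e2piD.
congr e2pi; rewrite mulrNz intrM.
by field; rewrite nat1r; exact: natrS_neq0.
Qed.

Lemma ae_neq (a : R) : {ae mu, forall x, x != a}.
Proof.
exists [set a]; split => //; first exact: lebesgue_measure_set1.
by move=> x /= /negP; rewrite negbK => /eqP.
Qed.

Context (U : R -> (R -> R[i]) -> R -> R[i]) (locU : local_translations Omega Lambda U).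

Lemma local_translation_comb (t : R) (s : seq R) (c : R -> R[i]) :
  (forall l, l \in s -> Lambda l) ->
  aeeq Omega (U t (fun x => \sum_(l <- s) c l * expfun l x))
    (fun x => \sum_(l <- s) c l * (e2pi (l * t) * expfun l x)).
Proof.
move=> sL; have [[Uu _ _ _] Ue] := locU.
apply: (unitary_comb _ (measurable_Omega alpha) (Uu t)) => l /sL Ll.
  exact: (L2_expfun mu_Omega spec).
exact: Ue.
Qed.

(** The difference [h] of the two sides vanishes on combinations of exponentials and is bounded in
    L^2. Fixing [c] keeps the right-hand side a finite sum of translates. *)
Lemma local_translation_entry (t : R) (c : int) i f : L2 Omega f ->
  {ae mu, forall x, 0 < x < P^-1 -> 0 < x + (t - c%:~R / P) < P^-1 ->
    U t f (x + (alpha i)%:~R / P) =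
    \sum_l (B ^ c) i l * f (x + (t - c%:~R / P + (alpha l)%:~R / P))}.
Proof.
move=> fL; set d := t - c%:~R / P.
have mO : measurable Omega := measurable_Omega alpha.
have [[Uu _ _ _] _] := locU.
have [UL _ Ulin _ _] := Uu t.
(* On [E] both [x] and [x + d] lie in the base interval, so every sampled point belongs to
   [Omega]. *)
pose E : set R := [set` `]0, P^-1[] `&` [set` `](- d), (P^-1 - d)[].
have mE : measurable E by apply: measurableI; exact: measurable_itv.
have EP x : E x <-> 0 < x < P^-1 /\ 0 < x + d < P^-1.
  by rewrite /E /= !in_itv/= ltrBrDr -(subr_gt0 (- d)) opprK.
have EO l x : E x -> Omega (x + (alpha l)%:~R / P).
  by move=> /EP[/Omega_translate + _]; exact.
have EOd l x : E x -> Omega (x + (d + (alpha l)%:~R / P)).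
  by move=> /EP[_ xd]; rewrite (addrA x d); exact: Omega_translate.
pose h g x := U t g (x + (alpha i)%:~R / P) +
  \sum_l - (B ^ c) i l * g (x + (d + (alpha l)%:~R / P)).
have mh1 g : L2 Omega g -> cmeasurable E (fun x => U t g (x + (alpha i)%:~R / P)).
  move=> /UL/L2P[mg _]; apply: (cmeasurable_translate mO _ mg) => x; exact: EO.
have mh2 g : L2 Omega g -> cmeasurable E (fun x =>
    \sum_l - (B ^ c) i l * g (x + (d + (alpha l)%:~R / P))).
  move=> /L2P[mg _]; apply: cmeasurable_sum => l; apply: cmeasurableZ.
  by apply: (cmeasurable_translate mO _ mg) => x; exact: EOd.
have mh g : L2 Omega g -> cmeasurable E (h g).
  by move=> gL; apply: cmeasurableD; [exact: mh1|exact: mh2].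
have [C C0 hC] := sqnorm_comb_translate_le (fun l => - (B ^ c) i l).
suff hf0 : {ae mu, forall x, E x -> h f x = 0}.
  move: hf0; apply: filterS => x hx x1 x2.
  have /hx/eqP : E x by apply/EP.
  rewrite addr_eq0 => /eqP ->; rewrite -sumrN.
  by apply: eq_bigr => l _; rewrite mulNr opprK.
(* A factor 2 arises from splitting [h] into its two terms: unitarity of [U t] bounds the first, [C]
   the second. *)
apply: (@sqnorm_small_ae0 _ E (h f) (2 + 2 * C)) => //; first exact: mh.
  by rewrite addr_ge0// mulr_ge0.
move=> e e0.
have [s [a [sL fs]]] := expfun_approx mu_Omega spec fL e0.
pose S x := \sum_(l <- s) a l * expfun l x.
pose g x := f x - S x.
have gL : L2 Omega g := L2_expfun_diff mu_Omega spec a fL sL.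
have SL : L2 Omega S.
  by apply: L2_comb => // l /sL; exact: (L2_expfun mu_Omega spec).
(* Here [f = g + S], and [S] contributes nothing to [h]. *)
have hfg : {ae mu, forall x, E x -> h f x = h g x}.
  have := Ulin 1 _ _ gL SL.
  have -> : (fun x => 1 * g x + S x) = f.
    by apply/funext => x; rewrite mul1r /g subrK.
  move=> /(ae_translate ((alpha i)%:~R / P)).
  have := ae_translate ((alpha i)%:~R / P) (local_translation_comb t a sL).
  apply: filterS2 => x US Uf Ex.
  rewrite /h (Uf (EO i x Ex)) (US (EO i x Ex)) mul1r -!addrA; congr (_ + _).
  apply/eqP; rewrite -subr_eq0 -addrA -sumrB.
  under [X in _ + X]eq_bigr => l _ do rewrite -mulrBr /g opprB addrC subrK mulNr.
  rewrite sumrN subr_eq0; apply/eqP.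
  under [RHS]eq_bigr => l _ do rewrite /S mulr_sumr.
  (* Grouping by frequency rather than by interval reduces the claim to single exponentials. *)
  rewrite exchange_big /= !big_seq; apply: eq_bigr => l /sL Ll.
  have := congr1 (fun A : 'cV[R[i]]_n.+1 => A i 0) (expfun_local_translation t x c Ll).
  rewrite !mxE => ->; rewrite mulr_sumr; apply: eq_bigr => k _.
  by rewrite !mxE mulrCA -(addrA x t) -/d -(addrA x d).
have -> : sqnorm E (h f) = sqnorm E (h g).
  apply: ge0_ae_eq_integral => //.
  - by apply: cmeasurable_modulus_sqr; exact: mh.
  - by apply: cmeasurable_modulus_sqr; exact: mh.
  - by move=> x _; rewrite lee_fin sqr_ge0.
  - by move=> x _; rewrite lee_fin sqr_ge0.
  - by move: hfg; apply: filterS => x /[apply] ->.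
apply: le_trans (sqnormD_le mE (mh1 _ gL) (mh2 _ gL)) _.
have /L2P[mg _] := gL; have /L2P[mUg _] := UL _ gL.
have gs : (sqnorm Omega g <= (e ^+ 2)%:E)%E := fs.
rewrite mulrDl [leRHS]EFinD; apply: leeD.
  rewrite EFinM lee_wpmul2l// (le_trans _ gs)// -(unitary_sqnorm (Uu t) gL).
  apply: (sqnorm_translate_le mO mE _ mUg) => x; exact: EO.
rewrite -mulrA EFinM lee_wpmul2l//.
apply: le_trans (hC _ _ _ _ mO mE EOd mg) _.
by rewrite EFinM lee_wpmul2l// lee_fin.
Qed.

(** The integer finally used varies with [x], so one null set must serve all [c]: a countable union
    of null sets, taken over the two halves of [int]. *)
Lemma local_translation_sample (t : R) f : L2 Omega f ->
  {ae mu, forall x, forall c : int, 0 < x < P^-1 ->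
    0 <= x + t - c%:~R / P < P^-1 ->
    sample alpha (U t f) x = B ^ c *m sample alpha f (x + t - c%:~R / P)}.
Proof.
move=> fL.
have aec (c : int) : {ae mu, forall x, 0 < x < P^-1 ->
    0 <= x + t - c%:~R / P < P^-1 ->
    sample alpha (U t f) x = B ^ c *m sample alpha f (x + t - c%:~R / P)}.
  (* Discards the point where the shifted argument is 0, since the entrywise formula requires it to
     be strictly positive. *)
  have := ae_neq (- (t - c%:~R / P)).
  have : {ae mu, forall x, forall i, 0 < x < P^-1 -> 0 < x + (t - c%:~R / P) < P^-1 ->
    U t f (x + (alpha i)%:~R / P) =
    \sum_l (B ^ c) i l * f (x + (t - c%:~R / P + (alpha l)%:~R / P))}.
    by apply: filter_forall => i; exact: local_translation_entry.
  apply: filterS2 => x hx xn x1 /andP[x2 x3].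
  apply/matrixP => i z; rewrite !mxE hx// ?addrA ?x3 ?andbT; last first.
    by rewrite lt_neqAle x2 andbT eq_sym -addrA addr_eq0.
  by apply: eq_bigr => l _; rewrite !mxE !addrA.
have pos := @ae_foralln _ _ _ mu _ (fun m : nat => aec (Posz m)).
have neg := @ae_foralln _ _ _ mu _ (fun m : nat => aec (Negz m)).
by move: pos neg; apply: filterS2 => x hp hn [m|m]; [exact: hp|exact: hn].
Qed.

End LocalTranslations.

Local Open Scope sesquilinear_scope.

Theorem theorem4p14 (R : realType) (n : nat)
    (alpha : 'I_n.+1 -> int) (Lambda : set R) (lambda : 'I_n.+1 -> R)
    (U : R -> (R -> R[i]) -> R -> R[i]) (B : 'M[R[i]]_n.+1) :
  let Omega := Omega_ R alpha in
  lebesgue_measure Omega = 1%E ->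
  alpha ord0 = 0 ->
  (forall i j : 'I_n.+1, (i < j)%N -> alpha i < alpha j) ->
  has_spectrum Omega Lambda ->
  has_period Lambda n.+1%:R ->
  Lambda = [set lambda j + n.+1%:R * k%:~R | j in [set: 'I_n.+1] & k in [set: int]] ->
  lambda ord0 = 0 ->
  local_translations Omega Lambda U ->
  spectral_unitary_matrix alpha Lambda B ->
  B = M_ alpha lambda *m D_ lambda *m (M_ alpha lambda)^t* /\
  forall a : R -> int,
    (forall x, 0 <= x - (a x)%:~R / n.+1%:R < n.+1%:R^-1) ->
    forall f, L2 Omega f -> forall t : R,
      {ae @lebesgue_measure R, forall x, 0 < x < n.+1%:R^-1 ->
         sample alpha (U t f) x =
         B ^ a (x + t) *m sample alpha f (x + t - (a (x + t))%:~R / n.+1%:R)}.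
Proof.
move=> Omega mu1 _ incr spec _ LE _ locU specB; split.
  exact: (B_diagonalisation incr mu1 spec LE specB).
move=> a ha f fL t.
move: (local_translation_sample mu1 spec LE specB locU t fL).
(* At each point the integer is specialised to [a (x + t)]. *)
by apply: filterS => x hx x01; exact: hx.
Qed.
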